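(* Every rapid $P$-point is a Laver ultrafilter; that is, if an ultrafilter $\mathcal{U}$ over $\omega$ is both rapid and a $P$-point, then $\mathcal{U}$ is a Laver ultrafilter.
   Context: By an ultrafilter we always mean a non-principal ultrafilter. Laver ultrafilter: an ultrafilter $\mathcal{U}$ over $\omega$ is a Laver ultrafilter if for every sequence $\langle \mathcal{P}_n : n\in\omega\rangle$, where each $\mathcal{P}_n$ is a partition of $\omega$ into finitely many sets, there exists $x\in\mathcal{U}$ such that for all $n\in\omega$, $x$ has non-empty intersection with at most $n+1$ elements of $\mathcal{P}_n$. $P$-point: $\mathcal{U}$ is a $P$-point if for every sequence $\langle x_n : n\in\omega\rangle$ of elements of $\mathcal{U}$ there is $x\in\mathcal{U}$ with $x\subseteq^{\ast}x_n$ (i.e. $x\setminus x_n$ finite) for all $n$. Rapid: $\mathcal{U}$ is rapid if for every strictly increasing $f\in\omega^\omega$ there is $x\in\mathcal{U}$ with $|x\cap f(n)|\le n$ for all $n\in\omega$ (where $f(n)=\{0,\dots,f(n)-1\}$). *)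

(* Defs.v *)
From mathcomp Require Import all_boot.
From mathcomp Require Import boolp classical_sets functions cardinality filter.

Set Implicit Arguments.
Unset Strict Implicit.
Unset Printing Implicit Defensive.

Local Open Scope classical_set_scope.
Local Open Scope card_scope.

Definition nonprincipal_ultrafilter (U : set_system nat) : Prop :=
  UltraFilter U /\ forall k : nat, U <> principal_filter k.

Definition almost_subset (x y : set nat) : Prop := finite_set (x `\` y).

Definition p_point (U : set_system nat) : Prop :=
  forall x_ : nat -> set nat, (forall n, U (x_ n)) ->
  exists2 x, U x & forall n, almost_subset x (x_ n).

(* The ordinal f n = {0, ..., f n - 1} is `I_(f n), and A #<= `I_n says that
   A has at most n elements. *)
Definition rapid (U : set_system nat) : Prop :=
  forall f : nat -> nat, (forall m n, m < n -> f m < f n) ->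
  exists2 x, U x & forall n, x `&` `I_(f n) #<= `I_n.

Definition laver (U : set_system nat) : Prop :=
  forall P : nat -> set (set nat),
  (forall n, finite_set (P n) /\ partition (P n) id [set: nat]) ->
  exists2 x, U x &
    forall n, [set A | P n A /\ x `&` A !=set0] #<= `I_n.+1.

(* Main.v *)
Require Import Defs.
From mathcomp Require Import all_boot.
From mathcomp Require Import boolp classical_sets functions cardinality filter.

(** Some set in [U] lies, up to finitely many points, in a single block of each
    partition, and rapidity thins out those exceptional points.

    For every [n] the ultrafilter selects a block [B n] of the finite partition
    [P n] ([ultra_finite_cover]).  The P-point property gives one [y] in [U]
    that is almost contained in every [B n]; as a finite set of numbers is
    bounded ([finite_set_nat_bounded]), the part of [y] outside [B n] lies below
    some [g n], and [g] may be replaced by a strictly increasing [f] above it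
    ([strictly_increasing_majorant]).  Rapidity applied to [f] gives [z] in [U]
    with at most [n] elements below [f n].  Then [z `&` y] is a Laver witness:
    a block of [P n] that it meets is either [B n] or the block of one of the at
    most [n] elements of [z] below [f n], which makes at most [n + 1] blocks. *)

Set Implicit Arguments.
Unset Strict Implicit.
Unset Printing Implicit Defensive.

Local Open Scope classical_set_scope.
Local Open Scope card_scope.

(** Otherwise the complements of the members all belong to [U], and so does
    their intersection, which is empty because the members cover [T]. *)
Lemma ultra_finite_cover (T : Type) (U : set_system T) (P : set (set T)) :
  UltraFilter U -> finite_set P -> cover P id = [set: T] ->
  exists2 A, P A & U A.
Proof.
move=> U_ultra /finite_fsetP[X ->] cov; apply: contrapT => noA.
apply: (@filter_not_empty _ U).
rewrite -setCT -cov /cover setC_bigcup.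
apply: filter_bigI => A XA.
by have [UA|//] := in_ultra_setVsetC A U_ultra; case: noA; exists A.
Qed.

Lemma finite_set_nat_bounded (A : set nat) :
  finite_set A -> exists N, A `<=` `I_N.
Proof.
move=> /finite_seqP[s ->]; exists (\max_(i <- s) i).+1 => i /= si.
exact: leq_bigmax_seq.
Qed.

Lemma strictly_increasing_majorant (g : nat -> nat) :
  exists2 f : nat -> nat, (forall m n, m < n -> f m < f n) &
    forall n, g n <= f n.
Proof.
exists (fun n => \sum_(k < n.+1) (g k).+1) => [|n].
  apply: (homo_ltn (r := fun m n => m < n)) => [? ? ?|n].
    exact: ltn_trans.
  by rewrite [ltnRHS]big_ord_recr /= -addSnnS leq_addr.
by rewrite big_ord_recr /= -addSnnS leq_addl.
Qed.

Lemma card_le_setU1 (T : pointedType) (a : T) (A : set T) n :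
  A #<= `I_n -> a |` A #<= `I_n.+1.
Proof.
move=> /pcard_surjP[h hA]; apply/pcard_surjP.
exists (fun i => if i == n then a else h i) => t /= [->|/hA[i /= ltin <-]].
  by exists n; rewrite /= ?eqxx.
by exists i; rewrite /= ?(ltn_eqF ltin) // ltnW.
Qed.

(** Sending a point of [D] to the member of [P] that contains it maps [D] onto
    the members that meet [D]. *)
Lemma card_le_met (T : Type) (P : set (set T)) (D : set T) :
  trivIset P id -> [set A | P A /\ D `&` A !=set0] #<= D.
Proof.
move=> /trivIsetP P_disj.
pose block t := get [set A | P A /\ A t].
suff met_block : [set A | P A /\ D `&` A !=set0] `<=` block @` D.
  exact: card_le_trans (subset_card_le met_block) (card_image_le _ _).
move=> A [PA [t [Dt At]]]; exists t => //.
rewrite /block; case: xgetP => [B _ [PB Bt]|/(_ A)]; last by case.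
apply: contrapT => /eqP neBA.
by have /= := P_disj _ _ PB PA neBA; rewrite -subset0 => /(_ t); apply.
Qed.

Theorem proposition3p3 (U : set_system nat)
  (U_ultra : nonprincipal_ultrafilter U) (U_rapid : rapid U)
  (U_p_point : p_point U) :
  laver U.
Proof.
move=> P P_part; have [U_uf _] := U_ultra.
have /choice[B /all_and2[PB UB]] n : exists A, P n A /\ U A.
  have [fin [cov _ _]] := P_part n.
  by have [A] := ultra_finite_cover U_uf fin cov; exists A.
have [y Uy y_sub] := U_p_point B UB.
have /choice[g y_g] n := finite_set_nat_bounded (y_sub n).
have [f f_incr le_gf] := strictly_increasing_majorant g.
have [z Uz z_thin] := U_rapid f f_incr.
exists (z `&` y) => [|n]; first exact: filterI.
have [_ [_ P_disj _]] := P_part n.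
pose D := z `&` `I_(f n).
have D_met : [set A | P n A /\ D `&` A !=set0] #<= `I_n.
  exact: card_le_trans (card_le_met D P_disj) (z_thin n).
apply: card_le_trans (card_le_setU1 (B n) D_met).
apply: subset_card_le => A [PA [t [[zt yt] At]]].
have [->|neAB] := eqVneq A (B n); [by left | right; split => //].
(* A block other than [B n] meets [y] only below [g n]. *)
exists t; split=> //; split=> //=; apply: leq_trans (le_gf n).
apply: y_g; split=> // Bt.
have /trivIsetP/(_ _ _ PA (PB n) neAB) := P_disj.
by rewrite -subset0 => /(_ t); apply.
Qed.
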